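(* Let $f(z)=\sum_{n=0}^{\infty}a_nz^n$ and $h(z)=\sum_{n=0}^{\infty}b_nz^n$ be analytic in $\mathbb{D}$ and suppose $f\prec h$ in $\mathbb{D}$. Then for every $k\in\{0,1,2,\dots\}$ and every $z$ with $|z|\leq 1/2$, $$\left|a_0+a_1z+\cdots+a_kz^k\right|\leq \sum_{n=0}^{k}|b_n||z|^n.$$
   Context: $\mathbb{D}=\{z\in\mathbb{C}:|z|<1\}$. A Schwarz function is an analytic function $\varphi$ on $\mathbb{D}$ with $\varphi(0)=0$ and $|\varphi(z)|\le 1$ for all $z\in\mathbb{D}$. For analytic $f,h$ in $\mathbb{D}$, $f$ is subordinate to $h$, written $f\prec h$, if there is a Schwarz function $\varphi$ with $f(z)=h(\varphi(z))$ for all $z\in\mathbb{D}$. Convention: $0^0=1$. *)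

(* Defs.v *)
From Stdlib Require Import Reals.
From Coquelicot Require Import Coquelicot.

Definition unit_disc (z : C) : Prop := (Cmod z < 1)%R.

Definition has_power_series_at (f : C -> C) (z0 : C) (c : nat -> C) (r : R) : Prop :=
  forall z : C, (Cmod (z - z0)%C < r)%R ->
    @is_pseries C_AbsRing C_NormedModule c (z - z0)%C (f z).

(* Values of f outside an open set U are irrelevant: at each point of U the
   radius r may be taken so small that the disc of radius r stays inside U. *)
Definition analytic_on (U : C -> Prop) (f : C -> C) : Prop :=
  forall z0 : C, U z0 ->
    exists (r : R) (c : nat -> C), (0 < r)%R /\
      (forall z : C, (Cmod (z - z0)%C < r)%R -> U z) /\
      has_power_series_at f z0 c r.

Definition schwarz_function (phi : C -> C) : Prop :=
  analytic_on unit_disc phi /\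
  phi (RtoC 0) = RtoC 0 /\
  (forall z : C, unit_disc z -> (Cmod (phi z) <= 1)%R).

(* The bound |phi| <= 1 and phi 0 = 0 force |phi| < 1 on the disc (maximum
   principle), so h is only evaluated inside the disc. *)
Definition subordinate (f h : C -> C) : Prop :=
  exists phi : C -> C, schwarz_function phi /\
    forall z : C, unit_disc z -> f z = h (phi z).

(* Main.v *)
Require Import Defs.
From Stdlib Require Import Reals Lra Lia Classical ClassicalEpsilon.
From Coquelicot Require Import Coquelicot.

Local Open Scope R_scope.

(** The proof rests on Rogosinski's theorem: if [g] is analytic on the unit disc
    with [|g| <= 1], every partial sum of its Taylor series is bounded by 1 on
    [|z| <= 1/2] ([partial_sum_bounded]).  Granting it, write [f = h o phi] and
    [phi = z psi] with [|psi| <= 1], by the Schwarz lemma.  Near 0,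
    [f = sum_m b_m phi^m] with [phi^m = z^m psi^m], so modulo [z^(k+1)] the
    terms with [m > k] do not count, and the partial sum of order [k] of [f] is
    the sum over [m <= k] of [b_m] times that of [phi^m].  The latter is [z^m]
    times a partial sum of [psi^m], hence at most [|z|^m] in modulus.

    Rogosinski's theorem comes from the kernel [2 Re (1 + x + ... + x^n) - 1],
    which is nonnegative for [|x| <= 1/2] ([Re_geom_ge_half]).  Averaging the
    rotated functions [g (u_j .)] over the [(N+1)]-st roots of unity [u_j], with
    the kernel at [x = z / u_j] as weight, gives a function [G] bounded by 1
    whose coefficients of index at most [N - n] are those of the polynomial
    [P(x) = sum_(i <= n) d_i z^i x^i] ([weight_fourier]), [d_i] being the
    coefficients of [g].  So [G - P] vanishes at 0 to an order that grows with
    [N], while its bound on the disc does not depend on [N].  The Schwarz lemma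
    for zeros of high order yields [|P(x)| <= 1 + B |x|^M] for every [M]; then
    [M] goes to infinity and [x] to 1.

    The class of functions in which all this takes place consists of those with
    an asymptotic expansion to all orders at each point of the disc
    ([expandable]).  It contains the analytic functions, is stable under
    products and under division by [z], and satisfies the maximum principle,
    because that principle follows from the expansion of order 2 at a maximum
    point ([no_strict_subharmonic_max]). *)

(** * Finite sums and truncated power series *)

Definition Csum (u : nat -> C) (n : nat) : C := @sum_n C_AbelianMonoid u n.
Definition Rsum (u : nat -> R) (n : nat) : R := @sum_n R_AbelianMonoid u n.

Lemma Csum_O (u : nat -> C) : Csum u 0 = u O.
Proof. exact (@sum_O C_AbelianMonoid u). Qed.

Lemma Csum_S (u : nat -> C) n : Csum u (S n) = (Csum u n + u (S n))%C.
Proof. exact (@sum_Sn C_AbelianMonoid u n). Qed.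

Lemma Rsum_O (u : nat -> R) : Rsum u 0 = u O.
Proof. exact (@sum_O R_AbelianMonoid u). Qed.

Lemma Rsum_S (u : nat -> R) n : Rsum u (S n) = Rsum u n + u (S n).
Proof. exact (@sum_Sn R_AbelianMonoid u n). Qed.

Lemma Csum_ext (u v : nat -> C) n :
  (forall i, (i <= n)%nat -> u i = v i) -> Csum u n = Csum v n.
Proof. exact (@sum_n_ext_loc C_AbelianMonoid u v n). Qed.

Lemma Csum_plus (u v : nat -> C) n :
  Csum (fun i => u i + v i)%C n = (Csum u n + Csum v n)%C.
Proof. exact (@sum_n_plus C_AbelianMonoid u v n). Qed.

Lemma Csum_scal (x : C) (u : nat -> C) n :
  Csum (fun i => x * u i)%C n = (x * Csum u n)%C.
Proof. exact (sum_n_mult_l (K := C_Ring) x u n). Qed.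

Lemma Csum_switch (u : nat -> nat -> C) m n :
  Csum (fun i => Csum (u i) n) m = Csum (fun j => Csum (fun i => u i j) m) n.
Proof. exact (@sum_n_switch C_AbelianMonoid u m n). Qed.

Lemma Csum_head (u : nat -> C) n :
  Csum u (S n) = (u O + Csum (fun i => u (S i)) n)%C.
Proof.
  induction n as [|n IH].
  - now rewrite Csum_S, !Csum_O.
  - rewrite Csum_S, IH, Csum_S. ring.
Qed.

Lemma Csum_kronecker (x : nat -> C) (i n : nat) :
  Csum (fun l => x l * (if Nat.eqb l i then 1 else 0))%C n
  = (if Nat.leb i n then x i else RtoC 0).
Proof.
  induction n as [|n IH].
  - rewrite Csum_O. destruct i as [|i]; simpl; ring.
  - rewrite Csum_S, IH.
    destruct (Nat.leb_spec i n); destruct (Nat.leb_spec i (S n));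
      destruct (Nat.eqb_spec (S n) i) as [e|]; try lia; try ring.
    rewrite e. ring.
Qed.

Lemma Cmod_Csum (u : nat -> C) n :
  Cmod (Csum u n) <= Rsum (fun i => Cmod (u i)) n.
Proof.
  induction n as [|n IH].
  - rewrite Csum_O, Rsum_O. lra.
  - rewrite Csum_S, Rsum_S. generalize (Cmod_triangle (Csum u n) (u (S n))). lra.
Qed.

Lemma Rsum_le (u v : nat -> R) n :
  (forall i, (i <= n)%nat -> u i <= v i) -> Rsum u n <= Rsum v n.
Proof.
  induction n as [|n IH]; intros H.
  - rewrite !Rsum_O. auto.
  - rewrite !Rsum_S. apply Rplus_le_compat; auto.
Qed.

Lemma Csum_conj (u : nat -> C) n : Cconj (Csum u n) = Csum (fun i => Cconj (u i)) n.
Proof.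
  induction n as [|n IH].
  - now rewrite !Csum_O.
  - now rewrite !Csum_S, Cplus_conj, IH.
Qed.

Lemma Rsum_nonneg (u : nat -> R) n : (forall i, 0 <= u i) -> 0 <= Rsum u n.
Proof.
  intros H. induction n as [|n IH]; [now rewrite Rsum_O|].
  rewrite Rsum_S. generalize (H (S n)). lra.
Qed.

Lemma Rsum_ge_term (u : nat -> R) n i :
  (forall i, 0 <= u i) -> (i <= n)%nat -> u i <= Rsum u n.
Proof.
  intros H. induction n as [|n IH]; intros Hi.
  - replace i with O by lia. rewrite Rsum_O. lra.
  - rewrite Rsum_S. destruct (Nat.eq_dec i (S n)) as [->|].
    + generalize (Rsum_nonneg u n H). lra.
    + generalize (IH ltac:(lia)) (H (S n)). lra.
Qed.

Lemma RtoC_Rsum (u : nat -> R) n : RtoC (Rsum u n) = Csum (fun i => RtoC (u i)) n.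
Proof.
  induction n as [|n IH].
  - now rewrite Rsum_O, Csum_O.
  - now rewrite Rsum_S, Csum_S, RtoC_plus, IH.
Qed.

Definition taylor (c : nat -> C) (n : nat) (w : C) : C :=
  Csum (fun i => c i * w ^ i)%C n.

Definition shift (c : nat -> C) (i : nat) : C := c (S i).

Lemma taylor_O c w : taylor c 0 w = c O.
Proof. unfold taylor. rewrite Csum_O. simpl. ring. Qed.

Lemma taylor_S c n w : taylor c (S n) w = (taylor c n w + c (S n) * w ^ S n)%C.
Proof. apply Csum_S. Qed.

Lemma taylor_head c n w : taylor c (S n) w = (c O + w * taylor (shift c) n w)%C.
Proof.
  unfold taylor. rewrite Csum_head, <- Csum_scal. f_equal.
  - simpl. ring.
  - apply Csum_ext. intros i _. unfold shift. simpl. ring.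
Qed.

Lemma taylor_ext c d n w :
  (forall i, (i <= n)%nat -> c i = d i) -> taylor c n w = taylor d n w.
Proof. intros H. apply Csum_ext. intros i Hi. now rewrite H. Qed.

Lemma taylor_plus c d n w :
  taylor (fun i => c i + d i)%C n w = (taylor c n w + taylor d n w)%C.
Proof.
  unfold taylor. rewrite <- Csum_plus. apply Csum_ext. intros i _. ring.
Qed.

Lemma taylor_scal x c n w : taylor (fun i => x * c i)%C n w = (x * taylor c n w)%C.
Proof.
  unfold taylor. rewrite <- Csum_scal. apply Csum_ext. intros i _. ring.
Qed.

Lemma taylor_at_0 c n : taylor c n 0 = c O.
Proof. destruct n; [apply taylor_O|]. rewrite taylor_head. ring. Qed.

(** * Asymptotic expansions *)

(** The bound is required at [w = 0] too; this makes the constant term of an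
    expansion the value of the function at the base point. *)
Definition bigO (n : nat) (E : C -> C) : Prop :=
  exists K r, 0 < r /\ forall w, Cmod w < r -> Cmod (E w) <= K * Cmod w ^ n.

Lemma bigO_ext_near n E E' r :
  0 < r -> (forall w, Cmod w < r -> E w = E' w) -> bigO n E -> bigO n E'.
Proof.
  intros Hr H (K & s & Hs & HE). exists K, (Rmin r s). split.
  - now apply Rmin_pos.
  - intros w Hw. rewrite <- H.
    + apply HE. apply Rlt_le_trans with (1 := Hw). apply Rmin_r.
    + apply Rlt_le_trans with (1 := Hw). apply Rmin_l.
Qed.

Lemma bigO_ext n E E' : (forall w, E w = E' w) -> bigO n E -> bigO n E'.
Proof. intros H. apply bigO_ext_near with 1; auto. lra. Qed.

Lemma bigO_zero n : bigO n (fun _ => RtoC 0).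
Proof.
  exists 0, 1. split; [lra|]. intros w _. rewrite Cmod_0. lra.
Qed.

Lemma bigO_const x : bigO 0 (fun _ => x).
Proof. exists (Cmod x), 1. split; [lra|]. intros w _. simpl. lra. Qed.

Lemma bigO_plus n E E' : bigO n E -> bigO n E' -> bigO n (fun w => E w + E' w)%C.
Proof.
  intros (K & r & Hr & HE) (K' & r' & Hr' & HE').
  exists (K + K'), (Rmin r r'). split; [now apply Rmin_pos|].
  intros w Hw.
  assert (h := HE w (Rlt_le_trans _ _ _ Hw (Rmin_l _ _))).
  assert (h' := HE' w (Rlt_le_trans _ _ _ Hw (Rmin_r _ _))).
  generalize (Cmod_triangle (E w) (E' w)). lra.
Qed.

Lemma bigO_mult n m E E' :
  bigO n E -> bigO m E' -> bigO (n + m) (fun w => E w * E' w)%C.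
Proof.
  intros (K & r & Hr & HE) (K' & r' & Hr' & HE').
  exists (K * K'), (Rmin r r'). split; [now apply Rmin_pos|].
  intros w Hw.
  assert (h := HE w (Rlt_le_trans _ _ _ Hw (Rmin_l _ _))).
  assert (h' := HE' w (Rlt_le_trans _ _ _ Hw (Rmin_r _ _))).
  rewrite Cmod_mult, pow_add.
  replace (K * K' * (Cmod w ^ n * Cmod w ^ m))
    with ((K * Cmod w ^ n) * (K' * Cmod w ^ m)) by ring.
  apply Rmult_le_compat; auto using Cmod_ge_0.
Qed.

Lemma bigO_scal n x E : bigO n E -> bigO n (fun w => x * E w)%C.
Proof. exact (bigO_mult 0 n _ _ (bigO_const x)). Qed.

Lemma bigO_minus n E E' : bigO n E -> bigO n E' -> bigO n (fun w => E w - E' w)%C.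
Proof.
  intros H H'. apply bigO_ext with (fun w => E w + (-(1)) * E' w)%C.
  - intros w. ring.
  - apply bigO_plus; [assumption|]. now apply bigO_scal.
Qed.

Lemma bigO_le m n E : (m <= n)%nat -> bigO n E -> bigO m E.
Proof.
  intros Hmn (K & r & Hr & HE). exists (Rabs K), (Rmin r 1).
  split; [apply Rmin_pos; lra|]. intros w Hw.
  assert (h := HE w (Rlt_le_trans _ _ _ Hw (Rmin_l _ _))).
  assert (h1 := Rlt_le_trans _ _ _ Hw (Rmin_r _ _)).
  assert (h0 := Cmod_ge_0 w).
  apply Rle_trans with (1 := h).
  replace n with (m + (n - m))%nat by lia. rewrite pow_add.
  assert (0 <= Cmod w ^ (n - m) <= 1) as [p0 p1].
  { split; [now apply pow_le|]. rewrite <- (pow1 (n - m)). apply pow_incr. lra. }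
  assert (q0 := pow_le _ m h0).
  apply Rle_trans with (Rabs K * (Cmod w ^ m * Cmod w ^ (n - m))).
  - apply Rmult_le_compat_r; [now apply Rmult_le_pos|apply Rle_abs].
  - apply Rmult_le_compat_l; [apply Rabs_pos|]. nra.
Qed.

Lemma bigO_sum n (E : nat -> C -> C) N :
  (forall j, (j <= N)%nat -> bigO n (E j)) -> bigO n (fun w => Csum (fun j => E j w) N).
Proof.
  induction N as [|N IH]; intros H.
  - apply bigO_ext with (2 := H O (Nat.le_refl _)). intros w. now rewrite Csum_O.
  - apply bigO_ext with (fun w => Csum (fun j => E j w) N + E (S N) w)%C.
    + intros w. now rewrite Csum_S.
    + apply bigO_plus; auto.
Qed.

Lemma bigO_pow n : bigO n (fun w => w ^ n)%C.
Proof.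
  exists 1, 1. split; [lra|]. intros w _. rewrite Cmod_pow. lra.
Qed.

Lemma bigO_taylor c n : bigO 0 (taylor c n).
Proof.
  apply bigO_sum with (E := fun i w => (c i * w ^ i)%C). intros i _.
  apply bigO_scal. apply bigO_le with (2 := bigO_pow i). lia.
Qed.

Lemma bigO_pow_mult n m E :
  bigO n E -> bigO (m + n) (fun w => w ^ m * E w)%C.
Proof. apply bigO_mult, bigO_pow. Qed.

Lemma bigO_compose n E p : bigO n E -> bigO 1 p -> bigO n (fun w => E (p w)).
Proof.
  intros (K & r & Hr & HE) (L & s & Hs & Hp).
  assert (L0 := Rabs_pos L). assert (L1 := Rle_abs L).
  exists (Rabs K * Rabs L ^ n), (Rmin s (r / (Rabs L + 1))). split.
  - apply Rmin_pos; [assumption|]. apply Rdiv_lt_0_compat; lra.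
  - intros w Hw.
    assert (w0 := Cmod_ge_0 w).
    assert (Hpw : Cmod (p w) <= Rabs L * Cmod w).
    { assert (h := Hp w (Rlt_le_trans _ _ _ Hw (Rmin_l _ _))). rewrite pow_1 in h. nra. }
    assert (small : Cmod (p w) < r).
    { assert (w1 := Rlt_le_trans _ _ _ Hw (Rmin_r _ _)).
      apply (Rmult_lt_compat_r (Rabs L + 1)) in w1; [|lra].
      unfold Rdiv in w1. rewrite Rmult_assoc, Rinv_l, Rmult_1_r in w1 by lra. nra. }
    apply Rle_trans with (1 := HE _ small).
    rewrite Rmult_assoc, <- Rpow_mult_distr.
    apply Rle_trans with (Rabs K * Cmod (p w) ^ n).
    + apply Rmult_le_compat_r; [apply pow_le, Cmod_ge_0|apply Rle_abs].
    + apply Rmult_le_compat_l; [apply Rabs_pos|]. apply pow_incr.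
      split; [apply Cmod_ge_0|assumption].
Qed.

(** An asymptotic expansion in the sense of Poincare.  The maximum principle and
    the comparison of coefficients use the order of contact at [z0], which
    passes to products and quotients by elementary estimates. *)
Definition asymp (F : C -> C) (z0 : C) (c : nat -> C) : Prop :=
  forall n, bigO (S n) (fun w => F (z0 + w) - taylor c n w)%C.

Definition expandable (F : C -> C) (z0 : C) : Prop := exists c, asymp F z0 c.

Lemma asymp_value F z0 c : asymp F z0 c -> F z0 = c O.
Proof.
  intros H. destruct (H O) as (K & r & Hr & HE).
  assert (h := HE 0%C). rewrite Cmod_0 in h. specialize (h Hr).
  rewrite taylor_O, pow_i, Rmult_0_r, Cplus_0_r in h by lia.
  replace (F z0) with (F z0 - c O + c O)%C by ring.
  rewrite (Cmod_eq_0 (F z0 - c O)); [ring|].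
  apply Rle_antisym; [exact h|apply Cmod_ge_0].
Qed.

Lemma asymp_ext_near F F' z0 c r :
  0 < r -> (forall z, Cmod (z - z0) < r -> F z = F' z) ->
  asymp F z0 c -> asymp F' z0 c.
Proof.
  intros Hr H HF n. apply bigO_ext_near with (3 := HF n) (1 := Hr).
  intros w Hw. rewrite H; [reflexivity|].
  now replace (z0 + w - z0)%C with w by ring.
Qed.

Lemma asymp_coef_ext F z0 c d : (forall i, c i = d i) -> asymp F z0 c -> asymp F z0 d.
Proof.
  intros H HF n. apply bigO_ext with (2 := HF n). intros w.
  now rewrite (taylor_ext c d) by auto.
Qed.

Lemma asymp_plus F G z0 c d :
  asymp F z0 c -> asymp G z0 d ->
  asymp (fun z => F z + G z)%C z0 (fun i => c i + d i)%C.
Proof.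
  intros HF HG n. apply bigO_ext with (2 := bigO_plus _ _ _ (HF n) (HG n)).
  intros w. rewrite taylor_plus. ring.
Qed.

Lemma asymp_scal x F z0 c :
  asymp F z0 c -> asymp (fun z => x * F z)%C z0 (fun i => x * c i)%C.
Proof.
  intros HF n. apply bigO_ext with (2 := bigO_scal _ x _ (HF n)).
  intros w. rewrite taylor_scal. ring.
Qed.

Lemma asymp_sum (F : nat -> C -> C) z0 (c : nat -> nat -> C) N :
  (forall j, (j <= N)%nat -> asymp (F j) z0 (c j)) ->
  asymp (fun z => Csum (fun j => F j z) N) z0 (fun i => Csum (fun j => c j i) N).
Proof.
  induction N as [|N IH]; intros H.
  - apply asymp_coef_ext with (c O). { intros i. now rewrite Csum_O. }
    apply asymp_ext_near with (F O) 1; [lra| |auto].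
    intros z _. now rewrite Csum_O.
  - apply asymp_coef_ext with (fun i => Csum (fun j => c j i) N + c (S N) i)%C.
    { intros i. now rewrite Csum_S. }
    apply asymp_ext_near with (fun z => Csum (fun j => F j z) N + F (S N) z)%C 1; [lra| |].
    { intros z _. now rewrite Csum_S. }
    apply asymp_plus; auto.
Qed.

Definition conv (c d : nat -> C) (k : nat) : C :=
  Csum (fun i => c i * d (k - i)%nat)%C k.

Lemma conv_S c d k : conv c d (S k) = (c O * d (S k) + conv (shift c) d k)%C.
Proof. unfold conv. now rewrite Csum_head. Qed.

(** By induction on [n]: splitting off the constant term of [c] multiplies the
    remaining error by [w]. *)
Lemma taylor_mult n : forall c d,
  bigO (S n) (fun w => taylor c n w * taylor d n w - taylor (conv c d) n w)%C.
Proof.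
  induction n as [|n IH]; intros c d.
  - apply bigO_ext with (2 := bigO_zero 1). intros w.
    rewrite !taylor_O. unfold conv. rewrite Csum_O. simpl. ring.
  - apply bigO_ext with (fun w =>
      w ^ 1 * (taylor (shift c) n w * taylor d n w - taylor (conv (shift c) d) n w)
      + w ^ (S (S n)) * (d (S n) * taylor (shift c) n w))%C.
    + intros w. rewrite (taylor_head c), (taylor_head (conv c d)).
      rewrite (taylor_ext (shift (conv c d))
                 (fun i => c O * shift d i + conv (shift c) d i)%C).
      2:{ intros i _. unfold shift at 1. now rewrite conv_S. }
      rewrite taylor_plus, taylor_scal.
      replace (conv c d O) with (c O * d O)%C
        by (unfold conv; rewrite Csum_O; reflexivity).
      transitivity (c O * taylor d (S n) w + w * taylor (shift c) n w * taylor d (S n) w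
        - (c O * (d O + w * taylor (shift d) n w) + w * taylor (conv (shift c) d) n w))%C.
      2:{ ring. }
      rewrite <- taylor_head, taylor_S. simpl. ring.
    + apply bigO_plus.
      * apply (bigO_pow_mult (S n) 1), IH.
      * replace (S (S n)) with (S (S n) + 0)%nat at 1 by lia.
        apply bigO_pow_mult. apply bigO_scal, bigO_taylor.
Qed.

Lemma asymp_mult F G z0 c d :
  asymp F z0 c -> asymp G z0 d -> asymp (fun z => F z * G z)%C z0 (conv c d).
Proof.
  intros HF HG n.
  apply bigO_ext with (fun w =>
    (taylor c n w * taylor d n w - taylor (conv c d) n w)
    + (taylor c n w * (G (z0 + w) - taylor d n w)
       + ((F (z0 + w) - taylor c n w) * (G (z0 + w) - taylor d n w)
          + taylor d n w * (F (z0 + w) - taylor c n w))))%C.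
  { intros w. ring. }
  apply bigO_plus; [apply taylor_mult|].
  apply bigO_plus; [apply (bigO_mult 0 (S n)); auto using bigO_taylor|].
  apply bigO_plus; [|apply (bigO_mult 0 (S n)); auto using bigO_taylor].
  apply bigO_le with (S n + S n)%nat; [lia|]. now apply bigO_mult.
Qed.

Lemma asymp_const x z0 : asymp (fun _ => x) z0 (fun i => match i with O => x | _ => RtoC 0 end).
Proof.
  intros n. apply bigO_ext with (2 := bigO_zero _). intros w.
  replace (taylor _ n w) with x; [ring|].
  induction n as [|n IH]; [now rewrite taylor_O|].
  rewrite taylor_S, <- IH. ring.
Qed.

Fixpoint conv_pow (c : nat -> C) (m : nat) : nat -> C :=
  match m with
  | O => fun i => match i with O => RtoC 1 | _ => RtoC 0 end
  | S m => conv c (conv_pow c m)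
  end.

Lemma asymp_pow F z0 c m : asymp F z0 c -> asymp (fun z => F z ^ m)%C z0 (conv_pow c m).
Proof.
  intros H. induction m as [|m IH].
  - exact (asymp_const 1 z0).
  - simpl. now apply asymp_mult.
Qed.

Lemma asymp_mult_id F c :
  asymp F 0 c ->
  asymp (fun z => z * F z)%C 0 (fun i => match i with O => RtoC 0 | S j => c j end).
Proof.
  intros HF [|n].
  - apply bigO_ext with (fun w => w ^ 1 * (F (0 + w) - c O) + c O * w ^ 1)%C.
    + intros w. rewrite taylor_O. replace (0 + w)%C with w by ring. simpl. ring.
    + apply bigO_plus; [|apply bigO_scal, bigO_pow].
      apply bigO_le with (1 + 1)%nat; [lia|]. apply bigO_pow_mult.
      apply bigO_ext with (2 := HF O). intros w. now rewrite taylor_O.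
  - apply bigO_ext with (2 := bigO_pow_mult _ 1 _ (HF n)).
    intros w. rewrite taylor_head. replace (0 + w)%C with w by ring. simpl.
    change (shift _) with c. ring.
Qed.

Lemma expandable_id z0 : expandable (fun z => z) z0.
Proof.
  exists (fun i => match i with O => z0 | S O => RtoC 1 | _ => RtoC 0 end).
  intros [|n].
  - apply bigO_ext with (2 := bigO_pow 1). intros w. rewrite taylor_O. simpl. ring.
  - apply bigO_ext with (2 := bigO_zero _). intros w.
    rewrite taylor_head.
    replace (taylor _ n w) with (RtoC 1); [ring|].
    induction n as [|n IH]; [now rewrite taylor_O|].
    rewrite taylor_S, <- IH. unfold shift. ring.
Qed.

Lemma expandable_mult F G z0 :
  expandable F z0 -> expandable G z0 -> expandable (fun z => F z * G z)%C z0.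
Proof. intros [c Hc] [d Hd]. exists (conv c d). now apply asymp_mult. Qed.

Lemma expandable_plus F G z0 :
  expandable F z0 -> expandable G z0 -> expandable (fun z => F z + G z)%C z0.
Proof. intros [c Hc] [d Hd]. eexists. apply asymp_plus; eassumption. Qed.

Lemma expandable_scal x F z0 : expandable F z0 -> expandable (fun z => x * F z)%C z0.
Proof. intros [c Hc]. eexists. apply asymp_scal; eassumption. Qed.

Lemma expandable_pow F m z0 : expandable F z0 -> expandable (fun z => F z ^ m)%C z0.
Proof. intros [c Hc]. exists (conv_pow c m). now apply asymp_pow. Qed.

Lemma expandable_sum (F : nat -> C -> C) z0 N :
  (forall j, (j <= N)%nat -> expandable (F j) z0) ->
  expandable (fun z => Csum (fun j => F j z) N) z0.
Proof.
  induction N as [|N IH]; intros H.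
  - destruct (H O (Nat.le_refl _)) as [c Hc]. exists c.
    apply asymp_ext_near with (3 := Hc) (r := 1); [lra|]. intros z _. now rewrite Csum_O.
  - destruct (expandable_plus _ _ _ (IH (fun j h => H j (Nat.le_trans _ _ _ h (Nat.le_succ_diag_r N))))
                (H _ (Nat.le_refl _))) as [c Hc].
    exists c. apply asymp_ext_near with (3 := Hc) (r := 1); [lra|].
    intros z _. now rewrite Csum_S.
Qed.

(** The error of the truncated geometric series of [1 / (z0 + w)] is exactly
    [(- w / z0)^(n+1) / (z0 + w)]. *)
Lemma expandable_inv (z0 : C) : z0 <> 0%C -> expandable Cinv z0.
Proof.
  intros Hz. exists (fun i => / z0 * (- / z0) ^ i)%C. intros n.
  assert (Hm : 0 < Cmod z0) by now apply Cmod_gt_0.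
  assert (main : forall w, (z0 + w)%C <> 0%C ->
    (/ (z0 + w) - taylor (fun i => / z0 * (- / z0) ^ i)%C n w)%C
    = (w ^ S n * ((- / z0) ^ S n * / (z0 + w)))%C).
  { intros w Hw. induction n as [|n IH].
    - rewrite taylor_O. simpl. field. auto.
    - rewrite taylor_S.
      transitivity ((/ (z0 + w) - taylor (fun i => / z0 * (- / z0) ^ i)%C n w)
                    - (/ z0 * (- / z0) ^ S n) * w ^ S n)%C; [ring|].
      rewrite IH. rewrite (Cpow_S w (S n)), (Cpow_S (- / z0) (S n)). field. auto. }
  assert (big : forall w, Cmod w < Cmod z0 / 2 -> Cmod z0 / 2 <= Cmod (z0 + w)).
  { intros w Hw. assert (h := Cmod_triangle (z0 + w) (- w)).
    rewrite Cmod_opp in h. replace (z0 + w + - w)%C with z0 in h by ring. lra. }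
  apply bigO_ext_near with (fun w => w ^ S n * ((- / z0) ^ S n * / (z0 + w)))%C (Cmod z0 / 2).
  - lra.
  - intros w Hw. symmetry. apply main. apply Cmod_gt_0. specialize (big w Hw). lra.
  - replace (S n) with (S n + 0)%nat at 1 by lia. apply bigO_pow_mult, bigO_scal.
    exists (2 / Cmod z0), (Cmod z0 / 2). split; [lra|]. intros w Hw.
    specialize (big w Hw). rewrite Cmod_inv by (apply Cmod_gt_0; lra).
    simpl. rewrite Rmult_1_r. replace (2 / Cmod z0) with (/ (Cmod z0 / 2)) by (field; lra).
    apply Rinv_le_contravar; lra.
Qed.

Lemma asymp_rotate F u z0 c :
  Cmod u = 1 -> asymp F (u * z0) c -> asymp (fun z => F (u * z))%C z0 (fun i => c i * u ^ i)%C.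
Proof.
  intros Hu HF n. destruct (HF n) as (K & r & Hr & HE). exists K, r. split; [assumption|].
  intros w Hw. assert (h := HE (u * w)%C). rewrite Cmod_mult, Hu, Rmult_1_l in h.
  replace (u * (z0 + w))%C with (u * z0 + u * w)%C by ring.
  replace (taylor _ n w) with (taylor c n (u * w)); [auto|].
  unfold taylor. apply Csum_ext. intros i _. rewrite Cpow_mult_l. ring.
Qed.

(** * Expansions of analytic functions *)

Lemma pseries_limit (c : nat -> C) (w l : C) :
  @is_pseries C_AbsRing C_NormedModule c w l ->
  forall eps, 0 < eps -> exists N, forall n, (N <= n)%nat -> Cmod (taylor c n w - l) < eps.
Proof.
  intros H eps Heps.
  destruct (proj1 (filterlim_locally_ball_norm _ _) H (mkposreal eps Heps)) as [N HN].
  exists N. intros n Hn. specialize (HN n Hn).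
  replace (taylor c n w) with
    (sum_n (fun k => scal (pow_n (w : C_AbsRing) k) (c k : C_NormedModule)) n).
  - exact HN.
  - apply sum_n_ext. intros k. change (scal ?x ?y) with (Cmult x y).
    replace (pow_n (w : C_AbsRing) k) with (Cpow w k); [apply Cmult_comm|].
    induction k as [|k IH]; [reflexivity|]. simpl. now rewrite IH.
Qed.

(** The terms of the series at [r / 2] are bounded, so on [|w| <= r / 4] the
    tail is dominated by a geometric series of ratio [1/2]. *)
Lemma asymp_pseries F z0 c r :
  0 < r ->
  (forall w, Cmod w < r -> @is_pseries C_AbsRing C_NormedModule c w (F (z0 + w)%C)) ->
  asymp F z0 c.
Proof.
  intros Hr Hser n. set (s := r / 2).
  assert (Hs : 0 < s) by (unfold s; lra).
  assert (bounded : exists A, 0 <= A /\ forall i, Cmod (c i) * s ^ i <= A).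
  { destruct (pseries_limit c (RtoC s) _ (Hser (RtoC s) ltac:(rewrite Cmod_R, Rabs_pos_eq; unfold s; lra))
                1 Rlt_0_1) as [N HN].
    assert (pos : forall i, 0 <= Cmod (c i) * s ^ i).
    { intros i. apply Rmult_le_pos; [apply Cmod_ge_0|apply pow_le; lra]. }
    exists (2 + Rsum (fun i => Cmod (c i) * s ^ i) N).
    assert (h := Rsum_nonneg _ N pos). split; [lra|]. intros i.
    destruct (Nat.le_gt_cases i N) as [Hi|Hi].
    - generalize (Rsum_ge_term _ N i pos Hi). lra.
    - destruct i as [|i]; [lia|].
      assert (h1 := HN (S i) ltac:(lia)). assert (h2 := HN i ltac:(lia)).
      rewrite <- Cmod_opp in h2.
      assert (h3 := Cmod_triangle (taylor c (S i) (RtoC s) - F (z0 + RtoC s))%C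
                      (- (taylor c i (RtoC s) - F (z0 + RtoC s)))%C).
      rewrite taylor_S in h1, h3.
      replace (_ + - _)%C with (c (S i) * RtoC s ^ S i)%C in h3 by ring.
      rewrite Cmod_mult, Cmod_pow, Cmod_R, (Rabs_pos_eq s) in h3 by lra. lra. }
  destruct bounded as (A & HA0 & HA).
  exists (2 * A / s ^ S n), (s / 2). split; [lra|]. intros w Hw.
  assert (w0 := Cmod_ge_0 w).
  set (q := Cmod w / s).
  assert (q0 : 0 <= q) by (apply Rdiv_le_0_compat; lra).
  assert (q1 : q <= 1 / 2).
  { unfold q. apply Rmult_le_reg_r with s; [lra|]. unfold Rdiv.
    rewrite Rmult_assoc, Rinv_l by lra. lra. }
  assert (Hq : forall i, Cmod w ^ i = s ^ i * q ^ i).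
  { intros i. rewrite <- Rpow_mult_distr. f_equal. unfold q. field. lra. }
  assert (qn := pow_le q (S n) q0).
  assert (tail : forall m, Cmod (taylor c (n + m) w - taylor c n w)
                           <= 2 * A * q ^ S n * (1 - (1 / 2) ^ m)).
  { induction m as [|m IH].
    - rewrite Nat.add_0_r. replace (_ - _)%C with (RtoC 0) by ring.
      rewrite Cmod_0. simpl. lra.
    - rewrite Nat.add_succ_r, taylor_S.
      replace (_ - _)%C with
        ((taylor c (n + m) w - taylor c n w) + c (S (n + m)) * w ^ S (n + m))%C by ring.
      apply Rle_trans with (1 := Cmod_triangle _ _).
      assert (Cmod (c (S (n + m)) * w ^ S (n + m)) <= A * (q ^ S n * (1 / 2) ^ m)).
      { rewrite Cmod_mult, Cmod_pow, Hq, <- Rmult_assoc.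
        replace (q ^ S (n + m)) with (q ^ S n * q ^ m) by (rewrite <- pow_add; reflexivity).
        apply Rmult_le_compat; auto.
        - apply Rmult_le_pos; [apply Cmod_ge_0|apply pow_le; lra].
        - apply Rmult_le_pos; auto. now apply pow_le.
        - apply Rmult_le_compat_l; auto. apply pow_incr. lra. }
      replace ((1/2) ^ S m) with (1/2 * (1/2)^m) by reflexivity. lra. }
  apply Rle_trans with (2 * A * q ^ S n).
  2:{ right. unfold q, Rdiv. rewrite Rpow_mult_distr, pow_inv. ring. }
  apply le_epsilon. intros eps Heps.
  destruct (pseries_limit c w _ (Hser w ltac:(unfold s in Hw; lra)) eps Heps) as [N HN].
  specialize (HN (n + N)%nat ltac:(lia)). specialize (tail N).
  rewrite <- Cmod_opp in HN.
  assert (h := Cmod_triangle (- (taylor c (n + N) w - F (z0 + w)))%C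
                 (taylor c (n + N) w - taylor c n w)%C).
  replace (_ + _)%C with (F (z0 + w) - taylor c n w)%C in h by ring.
  assert (p0 : 0 <= (1 / 2) ^ N) by (apply pow_le; lra).
  assert (0 <= 2 * A * q ^ S n) by (apply Rmult_le_pos; lra).
  nra.
Qed.

Lemma analytic_expandable U f z0 : analytic_on U f -> U z0 -> expandable f z0.
Proof.
  intros Hf Hz. destruct (Hf z0 Hz) as (r & c & Hr & _ & Hser). exists c.
  apply asymp_pseries with r; [assumption|]. intros w Hw.
  replace w with (z0 + w - z0)%C at 1 by ring. apply Hser.
  now replace (z0 + w - z0)%C with w by ring.
Qed.

(** * Maximum principle *)

(** Compactness of the closed disc, in the form of a common radius [d] for a
    local property that becomes weaker as its parameter decreases. *)
Lemma closed_disc_uniform (P : R -> C -> Prop) (rho : R) :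
  (forall d d' z, d <= d' -> 0 < d -> P d' z -> P d z) ->
  (forall p, Cmod p <= rho -> exists d, 0 < d /\
     forall z, Cmod z <= rho -> Cmod (z - p) < d -> P d z) ->
  exists d, 0 < d /\ forall z, Cmod z <= rho -> P d z.
Proof.
  intros mono loc.
  assert (gauge : forall p : C, exists d : posreal,
            forall z, Cmod z <= rho -> Cmod (z - p) < 2 * d -> P d z).
  { intros p. destruct (Rle_lt_dec (Cmod p) rho) as [Hp|Hp].
    - destruct (loc p Hp) as (d & Hd & H).
      assert (Hd2 : 0 < d / 2) by lra. exists (mkposreal _ Hd2). simpl.
      intros z Hz Hzp. apply mono with d; try lra. apply H; lra.
    - assert (Hd : 0 < (Cmod p - rho) / 2) by lra. exists (mkposreal _ Hd). simpl.
      intros z Hz Hzp. exfalso.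
      assert (h := Cmod_triangle z (- (z - p))%C). rewrite Cmod_opp in h.
      replace (z + - (z - p))%C with p in h by ring. lra. }
  set (delta := fun x y : R => proj1_sig (constructive_indefinite_description _ (gauge (x, y)))).
  destruct (compactness_value_2d (- rho) rho (- rho) rho delta) as [d Hd].
  exists d. split; [apply cond_pos|]. intros [x y] Hz. apply NNPP. intros nP.
  assert (hm := Rmax_Cmod (x, y)). simpl in hm.
  assert (hx : - rho <= x <= rho).
  { apply Rabs_le_between. eapply Rle_trans; [|exact Hz]. eapply Rle_trans; [apply Rmax_l|exact hm]. }
  assert (hy : - rho <= y <= rho).
  { apply Rabs_le_between. eapply Rle_trans; [|exact Hz]. eapply Rle_trans; [apply Rmax_r|exact hm]. }
  apply (Hd x y hx hy). intros (u & v & _ & _ & Hu & Hv & Hdd). apply nP.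
  apply mono with (delta u v); [assumption|apply cond_pos|].
  unfold delta in *.
  destruct (constructive_indefinite_description _ (gauge (u, v))) as [e He]. simpl in *.
  apply He; [assumption|].
  apply Rle_lt_trans with (1 := Cmod_2Rmax _). simpl.
  assert (sqrt 2 <= 2).
  { rewrite <- (sqrt_square 2) at 2 by lra. apply sqrt_le_1; lra. }
  assert (Rmax (Rabs (x + - u)) (Rabs (y + - v)) < e) by (apply Rmax_lub_lt; assumption).
  apply Rle_lt_trans with (2 * Rmax (Rabs (x + - u)) (Rabs (y + - v))); [|lra].
  apply Rmult_le_compat_r; [|assumption].
  eapply Rle_trans; [apply Rabs_pos|apply Rmax_l].
Qed.

Definition usc_at (u : C -> R) (p : C) : Prop :=
  forall eps, 0 < eps -> exists d, 0 < d /\ forall z, Cmod (z - p) < d -> u z < u p + eps.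

(** Compactness is used twice: with [u <= 1 / d] to bound [u], then, if the
    supremum [S] were not attained, with [u <= S - d] to contradict its
    minimality. *)
Lemma usc_attains_max (u : C -> R) (rho : R) :
  0 <= rho ->
  (forall p, Cmod p <= rho -> usc_at u p) ->
  exists p, Cmod p <= rho /\ forall z, Cmod z <= rho -> u z <= u p.
Proof.
  intros Hrho Husc.
  destruct (closed_disc_uniform (fun d z => u z <= / d) rho) as (d & Hd & Hbound).
  { intros d d' z Hdd Hd Hu. apply Rle_trans with (1 := Hu). now apply Rinv_le_contravar. }
  { intros p Hp. destruct (Husc p Hp 1 Rlt_0_1) as (d & Hd & H).
    assert (a0 := Rabs_pos (u p)). assert (a1 := Rle_abs (u p)).
    exists (Rmin d (/ (Rabs (u p) + 1))). split.
    { apply Rmin_pos; [assumption|]. apply Rinv_0_lt_compat. lra. }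
    intros z _ Hz.
    assert (h := H z (Rlt_le_trans _ _ _ Hz (Rmin_l _ _))).
    apply Rle_trans with (/ / (Rabs (u p) + 1)); [rewrite Rinv_inv; lra|].
    apply Rinv_le_contravar; [|apply Rmin_r].
    apply Rmin_pos; [assumption|]. apply Rinv_0_lt_compat. lra. }
  set (E := fun y => exists z, Cmod z <= rho /\ y = u z).
  destruct (completeness E) as [S [HS HS']].
  { exists (/ d). intros y (z & Hz & ->). auto. }
  { exists (u 0%C), 0%C. split; [rewrite Cmod_0; lra|reflexivity]. }
  apply NNPP. intros none.
  assert (below : forall p, Cmod p <= rho -> u p < S).
  { intros p Hp. destruct (Rle_lt_or_eq_dec (u p) S) as [|eq]; [apply HS; exists p; auto|assumption|].
    exfalso. apply none. exists p. split; [assumption|]. intros z Hz. rewrite eq. apply HS.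
    exists z; auto. }
  destruct (closed_disc_uniform (fun d z => u z <= S - d) rho) as (e & He & Hgap).
  { intros. lra. }
  { intros p Hp. assert (Hlt := below p Hp).
    destruct (Husc p Hp ((S - u p) / 2) ltac:(lra)) as (e & He & H).
    exists (Rmin e ((S - u p) / 2)). split; [apply Rmin_pos; lra|]. intros z _ Hz.
    assert (h := H z (Rlt_le_trans _ _ _ Hz (Rmin_l _ _))).
    generalize (Rmin_r e ((S - u p) / 2)). lra. }
  assert (S <= S - e); [|lra]. apply HS'. intros y (z & Hz & ->). auto.
Qed.

Lemma expandable_continuous F p :
  expandable F p ->
  forall eps, 0 < eps -> exists d, 0 < d /\ forall z, Cmod (z - p) < d -> Cmod (F z - F p) < eps.
Proof.
  intros [c Hc] eps Heps. assert (e := asymp_value _ _ _ Hc).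
  destruct (Hc O) as (K & r & Hr & H). assert (K0 := Rabs_pos K). assert (K1 := Rle_abs K).
  exists (Rmin r (eps / (Rabs K + 1))). split.
  { apply Rmin_pos; [assumption|]. apply Rdiv_lt_0_compat; lra. }
  intros z Hz. assert (h := H (z - p)%C (Rlt_le_trans _ _ _ Hz (Rmin_l _ _))).
  rewrite taylor_O, <- e, pow_1 in h. replace (p + (z - p))%C with z in h by ring.
  apply Rle_lt_trans with (1 := h).
  assert (h2 := Rlt_le_trans _ _ _ Hz (Rmin_r _ _)).
  apply (Rmult_lt_compat_r (Rabs K + 1)) in h2; [|lra].
  unfold Rdiv in h2. rewrite Rmult_assoc, Rinv_l, Rmult_1_r in h2 by lra.
  assert (z0 := Cmod_ge_0 (z - p)). nra.
Qed.

Lemma usc_Cmod_sq F p : expandable F p -> usc_at (fun z => Cmod (F z) ^ 2) p.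
Proof.
  intros HF eps Heps. assert (a0 := Cmod_ge_0 (F p)).
  set (a := Cmod (F p)) in *. set (eta := Rmin 1 (eps / (2 * a + 1))).
  assert (Heta : 0 < eta) by (apply Rmin_pos; [lra|apply Rdiv_lt_0_compat; lra]).
  destruct (expandable_continuous F p HF eta Heta) as (d & Hd & H).
  exists d. split; [assumption|]. intros z Hz. specialize (H z Hz).
  assert (t := Cmod_triangle (F z - F p) (F p)).
  replace (F z - F p + F p)%C with (F z) in t by ring. fold a in t.
  assert (b0 := Cmod_ge_0 (F z)).
  assert (e1 : eta <= 1) by apply Rmin_l.
  assert (e2 : eta * (2 * a + 1) <= eps).
  { apply Rle_trans with (eps / (2 * a + 1) * (2 * a + 1)).
    - apply Rmult_le_compat_r; [lra|apply Rmin_r].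
    - right. field. lra. }
  assert (Cmod (F z) < a + eta) by lra. nra.
Qed.

Lemma usc_plus u v p : usc_at u p -> usc_at v p -> usc_at (fun z => u z + v z) p.
Proof.
  intros Hu Hv eps Heps.
  destruct (Hu (eps / 2) ltac:(lra)) as (d & Hd & H).
  destruct (Hv (eps / 2) ltac:(lra)) as (d' & Hd' & H').
  exists (Rmin d d'). split; [now apply Rmin_pos|]. intros z Hz.
  assert (h := H z (Rlt_le_trans _ _ _ Hz (Rmin_l _ _))).
  assert (h' := H' z (Rlt_le_trans _ _ _ Hz (Rmin_r _ _))). lra.
Qed.

(** [|q|^2] lies above its tangent plane at [a]. *)
Lemma Cmod_sq_tangent (a q : C) :
  Cmod a ^ 2 + 2 * Re (Cconj a * (q - a)) <= Cmod q ^ 2.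
Proof.
  rewrite !Cmod2_alt. destruct a as [a1 a2], q as [q1 q2]. simpl.
  generalize (pow2_ge_0 (q1 - a1)) (pow2_ge_0 (q2 - a2)). simpl. lra.
Qed.

(** Averaging over [w = t, -t, i t, -i t] cancels the terms of order 1 and 2 of
    the expansion of [Q], so the mean of [|Q|^2] is at least [|Q p|^2] up to
    an error [O(t^3)], whereas the mean of [e |p + w|^2] exceeds [e |p|^2] by
    [e t^2]. *)
Lemma no_strict_subharmonic_max Q p e r :
  0 < e -> 0 < r -> expandable Q p ->
  (forall w, Cmod w < r ->
     Cmod (Q (p + w)%C) ^ 2 + e * Cmod (p + w) ^ 2 <= Cmod (Q p) ^ 2 + e * Cmod p ^ 2) ->
  False.
Proof.
  intros He Hr [c Hc] Hmax. assert (ev := asymp_value _ _ _ Hc).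
  destruct (Hc 2%nat) as (K & s & Hs & HE).
  set (a := Q p) in *. assert (a0 := Cmod_ge_0 a). assert (K0 := Rabs_pos K).
  (* The error in the average is at most [2 |a| |K| t^3]; [t L < e] makes it less than [e t^2]. *)
  set (L := 2 * Cmod a * Rabs K + 1).
  assert (L0 : 0 < L) by (unfold L; nra).
  set (t := Rmin (Rmin r s) (e / L) / 2).
  assert (t0 : 0 < Rmin (Rmin r s) (e / L)).
  { repeat apply Rmin_pos; auto. now apply Rdiv_lt_0_compat. }
  assert (t1 : t < r).
  { unfold t. generalize (Rle_trans _ _ _ (Rmin_l (Rmin r s) (e / L)) (Rmin_l r s)). lra. }
  assert (t2 : t < s).
  { unfold t. generalize (Rle_trans _ _ _ (Rmin_l (Rmin r s) (e / L)) (Rmin_r r s)). lra. }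
  assert (t3 : t * L < e).
  { apply Rlt_le_trans with (e / L * L); [|right; field; lra].
    apply Rmult_lt_compat_r; [assumption|]. unfold t.
    generalize (Rmin_r (Rmin r s) (e / L)). lra. }
  assert (tp : 0 < t) by (unfold t; lra).
  clearbody t.
  set (E := fun w => (Q (p + w) - taylor c 2 w)%C) in HE.
  assert (point : forall w, Cmod w = t ->
    2 * Re (Cconj a * (c 1%nat * w + c 2%nat * w ^ 2 + E w))
      + e * (Cmod (p + w) ^ 2 - Cmod p ^ 2) <= 0).
  { intros w Hw. assert (h := Hmax w ltac:(lra)).
    assert (g := Cmod_sq_tangent a (Q (p + w)%C)).
    replace (Q (p + w) - a)%C with (c 1%nat * w + c 2%nat * w ^ 2 + E w)%C in g.
    - lra.
    - unfold E. rewrite !taylor_S, taylor_O, ev. simpl. ring. }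
  assert (err : forall w, Cmod w = t -> Cmod (E w) <= Rabs K * t ^ 3).
  { intros w Hw. rewrite <- Hw. apply Rle_trans with (1 := HE w ltac:(lra)).
    apply Rmult_le_compat_r; [apply pow_le, Cmod_ge_0|apply Rle_abs]. }
  assert (m1 : Cmod (RtoC t) = t) by (rewrite Cmod_R; apply Rabs_pos_eq; lra).
  assert (m2 : Cmod (- RtoC t) = t) by now rewrite Cmod_opp.
  assert (m3 : Cmod (Ci * RtoC t) = t) by (rewrite Cmod_mult, Cmod_Ci; lra).
  assert (m4 : Cmod (- (Ci * RtoC t)) = t) by now rewrite Cmod_opp.
  assert (p1 := point _ m1). assert (p2 := point _ m2).
  assert (p3 := point _ m3). assert (p4 := point _ m4).
  assert (r1 := err _ m1). assert (r2 := err _ m2).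
  assert (r3 := err _ m3). assert (r4 := err _ m4).
  set (Es := (E (RtoC t) + E (- RtoC t) + (E (Ci * RtoC t) + E (- (Ci * RtoC t))))%C).
  assert (sumRe :
    Re (Cconj a * (c 1%nat * RtoC t + c 2%nat * RtoC t ^ 2 + E (RtoC t)))
    + Re (Cconj a * (c 1%nat * - RtoC t + c 2%nat * (- RtoC t) ^ 2 + E (- RtoC t)%C))
    + Re (Cconj a * (c 1%nat * (Ci * RtoC t) + c 2%nat * (Ci * RtoC t) ^ 2 + E (Ci * RtoC t)%C))
    + Re (Cconj a * (c 1%nat * - (Ci * RtoC t) + c 2%nat * (- (Ci * RtoC t)) ^ 2
                     + E (- (Ci * RtoC t))%C))
    = Re (Cconj a * Es)).
  { unfold Es. generalize (E (RtoC t)) (E (- RtoC t)%C) (E (Ci * RtoC t)%C) (E (- (Ci * RtoC t))%C)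
      (Cconj a) (c 1%nat) (c 2%nat).
    intros [] [] [] [] [] [] []. simpl. ring. }
  assert (sumMod :
    (Cmod (p + RtoC t) ^ 2 - Cmod p ^ 2) + (Cmod (p + - RtoC t) ^ 2 - Cmod p ^ 2)
    + (Cmod (p + Ci * RtoC t) ^ 2 - Cmod p ^ 2) + (Cmod (p + - (Ci * RtoC t)) ^ 2 - Cmod p ^ 2)
    = 4 * t ^ 2).
  { rewrite !Cmod2_alt. destruct p. simpl. ring. }
  assert (bound : - (Cmod a * (4 * (Rabs K * t ^ 3))) <= Re (Cconj a * Es)).
  { assert (g := re_le_Cmod (Cconj a * Es)). rewrite Cmod_mult, Cmod_conj in g.
    assert (Cmod Es <= 4 * (Rabs K * t ^ 3)).
    { unfold Es. eapply Rle_trans; [apply Cmod_triangle|].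
      eapply Rle_trans; [apply Rplus_le_compat; apply Cmod_triangle|]. lra. }
    assert (Cmod a * Cmod Es <= Cmod a * (4 * (Rabs K * t ^ 3))) by now apply Rmult_le_compat_l.
    apply Rabs_le_between in g. lra. }
  assert (total : 2 * Re (Cconj a * Es) + e * (4 * t ^ 2) <= 0).
  { rewrite <- sumRe, <- sumMod. lra. }
  assert (fin : e * t ^ 2 <= 2 * Cmod a * Rabs K * t ^ 3) by lra.
  assert (tt : 0 < t ^ 2) by (apply pow_lt; lra).
  assert (t ^ 2 * (t * L) < t ^ 2 * e) by now apply Rmult_lt_compat_l.
  unfold L in H. simpl in *. nra.
Qed.

(** Stated for [|z Q z| <= B], as the Schwarz lemma needs it: on the circle of
    radius [rho] the hypothesis gives [|Q| <= B / rho], with [rho] close to 1.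
    The term [e |z|^2] makes the subharmonic function [|Q|^2] strictly so, which
    excludes an interior maximum. *)
Lemma maximum_principle Q B :
  (forall z, unit_disc z -> expandable Q z) ->
  (forall z, unit_disc z -> Cmod z * Cmod (Q z) <= B) ->
  forall z, unit_disc z -> Cmod (Q z) <= B.
Proof.
  intros Hexp HB z1 Hz1. apply Rnot_lt_le. intros Hlt. unfold unit_disc in *.
  assert (B0 : 0 <= B).
  { assert (h := HB 0%C). rewrite Cmod_0 in h. specialize (h Rlt_0_1). lra. }
  set (q := Cmod (Q z1)) in *.
  assert (Bq : B / q < 1).
  { apply Rmult_lt_reg_r with q; [lra|]. unfold Rdiv. rewrite Rmult_assoc, Rinv_l by lra. lra. }
  set (rho := (Rmax (Cmod z1) (B / q) + 1) / 2).
  assert (h1 := Rmax_l (Cmod z1) (B / q)). assert (h2 := Rmax_r (Cmod z1) (B / q)).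
  assert (h3 : Rmax (Cmod z1) (B / q) < 1) by now apply Rmax_lub_lt.
  assert (h0 := Cmod_ge_0 z1).
  assert (rho1 : rho < 1) by (unfold rho; lra).
  assert (rho2 : Cmod z1 < rho) by (unfold rho; lra).
  assert (rho3 : B / q < rho) by (unfold rho; lra).
  clearbody rho.
  assert (rho4 : B < rho * q).
  { apply (Rmult_lt_compat_r q) in rho3; [|lra].
    unfold Rdiv in rho3. rewrite Rmult_assoc, Rinv_l, Rmult_1_r in rho3 by lra. lra. }
  set (b := B / rho).
  assert (Hb : b * rho = B) by (unfold b; field; lra).
  assert (b0 : 0 <= b) by (apply Rdiv_le_0_compat; lra).
  assert (bq : b < q) by nra.
  (* Small enough for the value at [z1] to exceed those on the circle of radius [rho] < 1. *)
  set (e := (q ^ 2 - b ^ 2) / 2).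
  assert (He : 0 < e) by (unfold e; nra).
  destruct (usc_attains_max (fun z => Cmod (Q z) ^ 2 + e * Cmod z ^ 2) rho) as (p & Hp & Hmax).
  { lra. }
  { intros p Hp. apply usc_plus; [apply usc_Cmod_sq, Hexp; lra|].
    intros eps Heps.
    destruct (usc_Cmod_sq _ p (expandable_id p) (eps / e) ltac:(apply Rdiv_lt_0_compat; lra))
      as (d & Hd & H).
    exists d. split; [assumption|]. intros z Hz. specialize (H z Hz). cbv beta in H.
    apply (Rmult_lt_compat_l e) in H; [|assumption].
    replace (e * (Cmod p ^ 2 + eps / e)) with (e * Cmod p ^ 2 + eps) in H by (field; lra).
    exact H. }
  assert (p0 := Cmod_ge_0 p).
  destruct (Rle_lt_or_eq_dec _ _ Hp) as [Hin|Hon].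
  - apply (no_strict_subharmonic_max Q p e (rho - Cmod p)); auto; try lra.
    + apply Hexp. lra.
    + intros w Hw. apply Hmax. generalize (Cmod_triangle p w). lra.
  - assert (g := Hmax z1 ltac:(lra)). cbv beta in g. fold q in g.
    assert (k := HB p ltac:(lra)). rewrite Hon in k, g.
    assert (k0 := Cmod_ge_0 (Q p)).
    assert (Cmod (Q p) <= b) by nra.
    assert (Cmod (Q p) ^ 2 <= b ^ 2) by (apply pow_incr; lra).
    assert (rho ^ 2 <= 1) by nra.
    assert (0 <= Cmod z1 ^ 2) by (apply pow_le; lra).
    unfold e in *. nra.
Qed.

(** The Schwarz lemma, with the quotient and its expansion made available, so
    that it can be iterated. *)
Lemma schwarz_division F B c :
  (forall z, unit_disc z -> expandable F z) ->
  (forall z, unit_disc z -> Cmod (F z) <= B) ->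
  asymp F 0 c -> c O = 0%C ->
  exists Q,
    (forall z, unit_disc z -> expandable Q z) /\
    (forall z, F z = (z * Q z)%C) /\
    (forall z, unit_disc z -> Cmod (Q z) <= B) /\
    asymp Q 0 (shift c).
Proof.
  intros Hexp HB Hc c0.
  set (Q := fun z => if Ceq_dec z 0 then c 1%nat else (F z * / z)%C).
  assert (HQ : forall z, F z = (z * Q z)%C).
  { intros z. unfold Q. destruct (Ceq_dec z 0) as [->|Hz].
    - rewrite (asymp_value _ _ _ Hc), c0. ring.
    - field. assumption. }
  assert (HQ0 : asymp Q 0 (shift c)).
  { intros n. destruct (Hc (S n)) as (K & r & Hr & HE). exists K, r. split; [assumption|].
    intros w Hw. destruct (Ceq_dec w 0) as [->|Hw0].
    - rewrite taylor_at_0, Cplus_0_r. unfold Q. destruct (Ceq_dec 0 0) as [_|nz]; [|now destruct nz].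
      unfold shift. replace (c 1%nat - c 1%nat)%C with (RtoC 0) by ring.
      rewrite Cmod_0, pow_i by lia. lra.
    - assert (h := HE w Hw). rewrite HQ, taylor_head, c0 in h.
      replace (0 + w)%C with w in * by ring.
      replace (w * Q w - (0 + w * taylor (shift c) n w))%C
        with (w * (Q w - taylor (shift c) n w))%C in h by ring.
      rewrite Cmod_mult in h. assert (w0 : 0 < Cmod w) by now apply Cmod_gt_0.
      apply Rmult_le_reg_l with (Cmod w); [assumption|]. simpl in *. lra. }
  assert (HQexp : forall z, unit_disc z -> expandable Q z).
  { intros z Hz. destruct (Ceq_dec z 0) as [->|Hz0]; [now exists (shift c)|].
    destruct (expandable_mult F Cinv z (Hexp z Hz) (expandable_inv z Hz0)) as [d Hd].
    exists d. apply asymp_ext_near with (3 := Hd) (r := Cmod z); [now apply Cmod_gt_0|].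
    intros y Hy. unfold Q. destruct (Ceq_dec y 0) as [->|]; [|reflexivity].
    replace (0 - z)%C with (- z)%C in Hy by ring. rewrite Cmod_opp in Hy. lra. }
  exists Q. repeat split; auto.
  apply maximum_principle; [assumption|]. intros z Hz.
  rewrite <- Cmod_mult, <- HQ. auto.
Qed.

Lemma schwarz_high_order M : forall F B c,
  (forall z, unit_disc z -> expandable F z) ->
  (forall z, unit_disc z -> Cmod (F z) <= B) ->
  asymp F 0 c -> (forall i, (i < M)%nat -> c i = 0%C) ->
  forall z, unit_disc z -> Cmod (F z) <= B * Cmod z ^ M.
Proof.
  induction M as [|M IH]; intros F B c Hexp HB Hc Hz z Hd.
  - simpl. rewrite Rmult_1_r. auto.
  - destruct (schwarz_division F B c) as (Q & HQ1 & HQ2 & HQ3 & HQ4); auto.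
    { apply Hz. lia. }
    assert (h := IH Q B (shift c) HQ1 HQ3 HQ4 (fun i Hi => Hz (S i) ltac:(lia)) z Hd).
    rewrite HQ2, Cmod_mult. simpl. generalize (Cmod_ge_0 z). nra.
Qed.

(** * Roots of unity and a positive kernel *)

Definition cis (t : R) : C := (cos t, sin t).

Lemma cis_plus s t : cis (s + t) = (cis s * cis t)%C.
Proof. unfold cis, Cmult. simpl. rewrite cos_plus, sin_plus. f_equal; ring. Qed.

Lemma cis_0 : cis 0 = 1%C.
Proof. unfold cis. now rewrite cos_0, sin_0. Qed.

Lemma cis_pow t n : (cis t ^ n)%C = cis (INR n * t).
Proof.
  induction n as [|n IH].
  - simpl. now rewrite Rmult_0_l, cis_0.
  - rewrite Cpow_S, IH, <- cis_plus, S_INR. f_equal. ring.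
Qed.

Lemma Cconj_cis t : Cconj (cis t) = cis (- t).
Proof. unfold cis, Cconj. simpl. now rewrite cos_neg, sin_neg. Qed.

Lemma Cmod_cis t : Cmod (cis t) = 1.
Proof.
  unfold Cmod, cis. simpl fst. simpl snd.
  rewrite <- sqrt_1. f_equal. generalize (sin2_cos2 t). unfold Rsqr. simpl. lra.
Qed.

Lemma cis_2PI : cis (2 * PI) = 1%C.
Proof. unfold cis. now rewrite cos_2PI, sin_2PI. Qed.

Lemma cis_neq_1 t : t <> 0 -> - (2 * PI) < t < 2 * PI -> cis t <> 1%C.
Proof.
  intros Ht Hr E. apply (f_equal fst) in E. simpl in E.
  replace t with (2 * (t / 2)) in E by field. rewrite cos_2a_sin in E.
  assert (s0 : sin (t / 2) = 0) by nra.
  destruct (Rtotal_order t 0) as [Hn|[|Hp]]; [|contradiction|].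
  - generalize (sin_gt_0 (- (t / 2)) ltac:(lra) ltac:(lra)). rewrite sin_neg. lra.
  - generalize (sin_gt_0 (t / 2) ltac:(lra) ltac:(lra)). lra.
Qed.

Definition geom (n : nat) (x : C) : C := Csum (fun l => x ^ l)%C n.

Lemma geom_closed n x : ((1 - x) * geom n x)%C = (1 - x ^ S n)%C.
Proof.
  unfold geom. induction n as [|n IH].
  - rewrite Csum_O. simpl. ring.
  - rewrite Csum_S, Cmult_plus_distr_l, IH, (Cpow_S x (S n)). ring.
Qed.

Definition root (N j : nat) : C := cis (INR j * (2 * PI / INR (S N))).

Lemma Cmod_root N j : Cmod (root N j) = 1.
Proof. apply Cmod_cis. Qed.

(** The sum is geometric, of ratio an [(N+1)]-st root of unity which equals 1
    only when [l = i]. *)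
Lemma root_orthogonality N l i :
  (l <= N)%nat -> (i <= N)%nat ->
  Csum (fun j => Cconj (root N j) ^ l * root N j ^ i)%C N
  = (INR (S N) * (if Nat.eqb l i then 1 else 0))%C.
Proof.
  intros Hl Hi. assert (SN : 0 < INR (S N)) by (apply lt_0_INR; lia).
  assert (pi := PI_RGT_0).
  set (t := (INR i - INR l) * (2 * PI / INR (S N))).
  transitivity (geom N (cis t)).
  { unfold geom. apply Csum_ext. intros j _. unfold root.
    rewrite Cconj_cis, !cis_pow, <- cis_plus. f_equal. unfold t. ring. }
  destruct (Nat.eqb_spec l i) as [->|Hne].
  - unfold t. replace (_ * _) with 0 by ring. rewrite cis_0.
    unfold geom. clear. induction N as [|N IH].
    + rewrite Csum_O. simpl. ring.
    + rewrite Csum_S, IH, Cpow_1_l, (S_INR (S N)), RtoC_plus. ring.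
  - assert (closed := geom_closed N (cis t)).
    replace (cis t ^ S N)%C with (RtoC 1) in closed.
    2:{ rewrite cis_pow. unfold t.
        replace (INR (S N) * ((INR i - INR l) * (2 * PI / INR (S N))))
          with (INR i * (2 * PI) + - (INR l * (2 * PI))) by (field; lra).
        rewrite cis_plus, <- Cconj_cis, <- !cis_pow, cis_2PI, !Cpow_1_l.
        unfold Cconj, Cmult, RtoC. simpl. f_equal; ring. }
    assert (ne : (1 - cis t)%C <> 0%C).
    { intros E. apply (cis_neq_1 t).
      - unfold t. intros E'. apply Rmult_integral in E'. destruct E' as [E'|E'].
        + apply Hne, INR_eq. lra.
        + assert (0 < 2 * PI / INR (S N)) by (apply Rdiv_lt_0_compat; lra). lra.
      - assert (hl := le_INR _ _ Hl). assert (hi := le_INR _ _ Hi).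
        assert (l0 := pos_INR l). assert (i0 := pos_INR i).
        assert (e : INR (S N) = INR N + 1) by apply S_INR.
        set (x := 2 * PI / INR (S N)) in *.
        assert (ex : x * INR (S N) = 2 * PI) by (unfold x; field; lra).
        assert (x0 : 0 < x) by (apply Rdiv_lt_0_compat; lra).
        unfold t. rewrite <- ex. split; nra.
      - replace (cis t) with (1 - (1 - cis t))%C by ring. rewrite E. ring. }
    replace (geom N (cis t)) with (/ (1 - cis t) * ((1 - cis t) * geom N (cis t)))%C
      by (field; assumption).
    rewrite closed. ring.
Qed.

(** With [s = geom n x], the claim [Re s >= 1/2] says that [|s - 1| <= |s|].
    Multiplied by [1 - x] this reads [|x - x^(n+1)| <= |1 - x^(n+1)|], which
    for [n >= 1] holds because [|x| + 2 |x|^(n+1) <= 1]. *)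
Lemma Re_geom_ge_half n x : Cmod x <= 1 / 2 -> 0 <= 2 * Re (geom n x) - 1.
Proof.
  intros Hx. assert (x0 := Cmod_ge_0 x).
  assert (cmp : Cmod (geom n x - 1) <= Cmod (geom n x)).
  { destruct n as [|n].
    { unfold geom. rewrite Csum_O. simpl. replace (1 - 1)%C with (RtoC 0) by ring.
      rewrite Cmod_0, Cmod_1. lra. }
    assert (e := geom_closed (S n) x).
    assert (ne : 0 < Cmod (1 - x)).
    { assert (h := Cmod_triangle (1 - x) x). replace (1 - x + x)%C with (RtoC 1) in h by ring.
      rewrite Cmod_1 in h. lra. }
    apply Rmult_le_reg_l with (Cmod (1 - x)); [assumption|].
    rewrite <- !Cmod_mult, e.
    replace ((1 - x) * (geom (S n) x - 1))%C with (x - x ^ S (S n))%C.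
    2:{ transitivity ((1 - x) * geom (S n) x - (1 - x))%C; [rewrite e|]; ring. }
    assert (h1 := Cmod_triangle x (- x ^ S (S n))). rewrite Cmod_opp in h1.
    assert (h2 := Cmod_triangle (1 - x ^ S (S n)) (x ^ S (S n))).
    replace (1 - x ^ S (S n) + x ^ S (S n))%C with (RtoC 1) in h2 by ring.
    rewrite Cmod_1 in h2. rewrite Cmod_pow in h1, h2.
    assert (p : Cmod x ^ S (S n) <= 1 / 4).
    { assert (Cmod x ^ n <= 1) by (rewrite <- (pow1 n); apply pow_incr; lra).
      assert (0 <= Cmod x ^ n) by now apply pow_le.
      simpl. assert (Cmod x * Cmod x ^ n <= 1 / 2) by nra. nra. }
    unfold Cminus in *. lra. }
  assert (sq : Cmod (geom n x - 1) ^ 2 <= Cmod (geom n x) ^ 2).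
  { apply pow_incr. split; [apply Cmod_ge_0|assumption]. }
  rewrite !Cmod2_alt in sq. destruct (geom n x) as [u v]. simpl in *. lra.
Qed.

(** The kernel [1 + 2 Re sum_(1 <= l <= n) x^l] at [x = z / u_j], where [u_j] is
    [root N j] and [Cconj u_j] its inverse. *)
Definition weight (N n : nat) (z : C) (j : nat) : R :=
  2 * Re (geom n (z * Cconj (root N j))) - 1.

Lemma weight_expand N n z j :
  RtoC (weight N n z j)
  = (geom n (z * Cconj (root N j)) + geom n (Cconj z * root N j) - 1)%C.
Proof.
  replace (geom n (Cconj z * root N j)) with (Cconj (geom n (z * Cconj (root N j)))).
  - unfold weight. destruct (geom n _) as [u v].
    unfold Cconj, RtoC, Cminus, Cplus, Copp. simpl. f_equal; ring.
  - unfold geom. rewrite Csum_conj. apply Csum_ext. intros l _.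
    now rewrite Cpow_conj, Cmult_conj, Cconj_conj.
Qed.

(** The kernel has the frequencies [-n, ..., n] only, so for [i + n <= N] no
    aliasing occurs: the sum extracts the coefficient [z^i] of the nonnegative
    frequencies up to [n], and the conjugate half contributes nothing but the
    constant term, which the [- 1] in the kernel removes. *)
Lemma weight_fourier N n z i :
  (i + n <= N)%nat ->
  Csum (fun j => RtoC (weight N n z j) * root N j ^ i)%C N
  = (INR (S N) * (if Nat.leb i n then z ^ i else 0))%C.
Proof.
  intros HN.
  transitivity (Csum (fun l => INR (S N) * (z ^ l * (if Nat.eqb l i then 1 else 0)))%C n
    + (Csum (fun l => INR (S N) * (Cconj z ^ l * (if Nat.eqb 0 (l + i) then 1 else 0)))%C n
       + (-(1)) * (INR (S N) * (if Nat.eqb 0 i then 1 else 0))))%C.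
  - transitivity (
      Csum (fun j => Csum (fun l => z ^ l * (Cconj (root N j) ^ l * root N j ^ i))%C n) N
      + (Csum (fun j => Csum (fun l => Cconj z ^ l * (Cconj (root N j) ^ 0 * root N j ^ (l + i)))%C n) N
      + Csum (fun j => (-(1)) * (Cconj (root N j) ^ 0 * root N j ^ i))%C N))%C.
    + rewrite <- !Csum_plus. apply Csum_ext. intros j _.
      rewrite weight_expand. unfold geom, Cminus.
      rewrite !Cmult_plus_distr_r.
      rewrite !(Cmult_comm (Csum _ _)), <- !Csum_scal, <- Cplus_assoc.
      f_equal; [|f_equal].
      * apply Csum_ext. intros l _. rewrite Cpow_mult_l. ring.
      * apply Csum_ext. intros l _. rewrite Cpow_mult_l, Cpow_add_r. simpl. ring.
      * simpl. ring.
    + f_equal; [|f_equal].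
      * rewrite Csum_switch. apply Csum_ext. intros l Hl.
        rewrite Csum_scal, root_orthogonality by lia. ring.
      * rewrite Csum_switch. apply Csum_ext. intros l Hl.
        rewrite Csum_scal, root_orthogonality by lia. ring.
      * rewrite Csum_scal, root_orthogonality by lia. ring.
  - rewrite !Csum_scal, Csum_kronecker.
    replace (Csum (fun l => Cconj z ^ l * (if Nat.eqb 0 (l + i) then 1 else 0))%C n)
      with (RtoC (if Nat.eqb 0 i then 1 else 0)).
    { destruct (Nat.eqb 0 i); ring. }
    destruct i as [|i].
    + simpl Nat.eqb at 1. cbv iota.
      transitivity (Csum (fun l => Cconj z ^ l * (if Nat.eqb l 0 then 1 else 0))%C n).
      * rewrite Csum_kronecker. reflexivity.
      * apply Csum_ext. intros l _. now rewrite Nat.add_0_r, Nat.eqb_sym.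
    + simpl Nat.eqb at 1. cbv iota.
      transitivity (Csum (fun l => 0 * 0)%C n).
      * rewrite Csum_scal. ring.
      * apply Csum_ext. intros l _. rewrite Nat.add_succ_r. simpl. ring.
Qed.

Lemma weight_total N n z : (n <= N)%nat -> Rsum (weight N n z) N = INR (S N).
Proof.
  intros HN. apply RtoC_inj. rewrite RtoC_Rsum.
  transitivity (Csum (fun j => RtoC (weight N n z j) * root N j ^ 0)%C N).
  - apply Csum_ext. intros j _. simpl. ring.
  - rewrite weight_fourier by assumption. simpl. ring.
Qed.

(** * Partial sums of bounded functions *)

Lemma asymp_taylor n : forall p,
  asymp (taylor p n) 0 (fun i => if Nat.leb i n then p i else RtoC 0).
Proof.
  induction n as [|n IH]; intros p.
  - apply asymp_coef_ext with (2 := asymp_ext_near _ (taylor p 0) 0 _ 1 Rlt_0_1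
                                      (fun z _ => eq_sym (taylor_O p z)) (asymp_const (p O) 0)).
    intros [|i]; reflexivity.
  - assert (h := asymp_plus _ _ _ _ _ (asymp_const (p O) 0) (asymp_mult_id _ _ (IH (shift p)))).
    apply asymp_coef_ext with (2 := asymp_ext_near _ (taylor p (S n)) 0 _ 1 Rlt_0_1
                                      (fun z _ => eq_sym (taylor_head p n z)) h).
    intros [|i]; [simpl; ring|]. simpl. unfold shift. destruct (Nat.leb i n); ring.
Qed.

Lemma expandable_taylor p n z0 : expandable (taylor p n) z0.
Proof.
  apply expandable_sum with (F := fun i z => (p i * z ^ i)%C). intros i _.
  apply expandable_scal, expandable_pow, expandable_id.
Qed.

Lemma Cmod_taylor_disc p n z :
  unit_disc z -> Cmod (taylor p n z) <= Rsum (fun i => Cmod (p i)) n.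
Proof.
  intros Hz. unfold taylor. apply Rle_trans with (1 := Cmod_Csum _ _).
  apply Rsum_le. intros i _. rewrite Cmod_mult, Cmod_pow.
  assert (Cmod z ^ i <= 1).
  { rewrite <- (pow1 i). apply pow_incr. split; [apply Cmod_ge_0|]. unfold unit_disc in Hz. lra. }
  generalize (Cmod_ge_0 (p i)). nra.
Qed.

(** With [N = n + M], the averaged function [G] has the same coefficients as the
    polynomial [taylor p n] up to index [M], and their difference is bounded by
    [1 + sum |p i|] whatever [M] is. *)
Lemma partial_sum_almost_bounded (g : C -> C) (d : nat -> C) (n M : nat) (z x : C) :
  (forall y, unit_disc y -> expandable g y) ->
  (forall y, unit_disc y -> Cmod (g y) <= 1) ->
  asymp g 0 d ->
  Cmod z <= 1 / 2 ->
  unit_disc x ->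
  let p := fun i => (d i * z ^ i)%C in
  Cmod (taylor p n x) <= 1 + (1 + Rsum (fun i => Cmod (p i)) n) * Cmod x ^ M.
Proof.
  intros g_expandable g_bounded g_asymp z_half Hx p.
  set (B := 1 + Rsum (fun i => Cmod (p i)) n). set (N := (n + M)%nat).
  assert (SN : 0 < INR (S N)) by (apply lt_0_INR; lia).
  assert (SNC : RtoC (INR (S N)) <> 0%C) by (intros E; apply RtoC_inj in E; lra).
  set (W := fun j => weight N n z j / INR (S N)).
  assert (W0 : forall j, 0 <= W j).
  { intros j. apply Rdiv_le_0_compat; [|assumption]. apply Re_geom_ge_half.
    rewrite Cmod_mult, Cmod_conj, Cmod_root. lra. }
  assert (W1 : Rsum W N = 1).
  { apply RtoC_inj. rewrite RtoC_Rsum.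
    transitivity (Csum (fun j => / INR (S N) * weight N n z j)%C N).
    - apply Csum_ext. intros j _. unfold W. rewrite RtoC_div by lra. field. assumption.
    - rewrite Csum_scal, <- RtoC_Rsum, weight_total by lia. field. assumption. }
  assert (disc_rot : forall y j, unit_disc y -> unit_disc (root N j * y)).
  { intros y j Hy. unfold unit_disc in *. rewrite Cmod_mult, Cmod_root. lra. }
  set (G := fun y => Csum (fun j => RtoC (W j) * g (root N j * y))%C N).
  assert (G_bounded : forall y, unit_disc y -> Cmod (G y) <= 1).
  { intros y Hy. rewrite <- W1. apply Rle_trans with (1 := Cmod_Csum _ _).
    apply Rsum_le. intros j _. rewrite Cmod_mult, Cmod_R, Rabs_pos_eq by auto.
    generalize (g_bounded _ (disc_rot y j Hy)) (W0 j). nra. }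
  assert (G_asymp : asymp G 0 (fun i => Csum (fun j => RtoC (W j) * (d i * root N j ^ i))%C N)).
  { apply asymp_sum with (F := fun j y => (RtoC (W j) * g (root N j * y))%C)
      (c := fun j i => (RtoC (W j) * (d i * root N j ^ i))%C).
    intros j _. apply asymp_scal, asymp_rotate; [apply Cmod_root|].
    now rewrite Cmult_0_r. }
  set (F := fun y => (G y + (-(1)) * taylor p n y)%C).
  assert (F_asymp := asymp_plus _ _ _ _ _ G_asymp (asymp_scal (-(1)) _ _ _ (asymp_taylor n p))).
  assert (F_bound : Cmod (F x) <= B * Cmod x ^ M).
  { apply schwarz_high_order with (3 := F_asymp); [| | |assumption].
    - intros y Hy. apply expandable_plus; [|apply expandable_scal, expandable_taylor].
      apply expandable_sum with (F := fun j y => (RtoC (W j) * g (root N j * y))%C).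
      intros j _. apply expandable_scal.
      destruct (g_expandable _ (disc_rot y j Hy)) as [e He]. eexists.
      apply asymp_rotate; [apply Cmod_root|exact He].
    - intros y Hy. apply Rle_trans with (1 := Cmod_triangle _ _).
      rewrite Cmod_mult, Cmod_opp, Cmod_1, Rmult_1_l.
      apply Rplus_le_compat; [auto|now apply Cmod_taylor_disc].
    - intros i Hi.
      replace (Csum _ N) with (d i * / INR (S N) *
        Csum (fun j => RtoC (weight N n z j) * root N j ^ i) N)%C.
      + rewrite weight_fourier by (unfold N; lia). unfold p.
        destruct (Nat.leb i n); field; assumption.
      + rewrite <- Csum_scal. apply Csum_ext. intros j _. unfold W.
        rewrite RtoC_div by lra. field. assumption. }
  assert (t := Cmod_triangle (G x) (- F x)). rewrite Cmod_opp in t.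
  replace (G x + - F x)%C with (taylor p n x) in t by (unfold F; ring).
  generalize (G_bounded x Hx). lra.
Qed.

(** Rogosinski's theorem.  Inside the disc the error term of the previous bound
    vanishes as [M] grows; the value at [z] is the limit of [taylor p n x] as
    [x] tends to 1. *)
Lemma partial_sum_bounded (g : C -> C) (d : nat -> C) (n : nat) (z : C) :
  (forall y, unit_disc y -> expandable g y) ->
  (forall y, unit_disc y -> Cmod (g y) <= 1) ->
  asymp g 0 d ->
  Cmod z <= 1 / 2 ->
  Cmod (taylor d n z) <= 1.
Proof.
  intros g_expandable g_bounded g_asymp z_half.
  set (p := fun i => (d i * z ^ i)%C). set (B := 1 + Rsum (fun i => Cmod (p i)) n).
  assert (B0 : 0 < B).
  { unfold B. generalize (Rsum_nonneg (fun i => Cmod (p i)) n (fun i => Cmod_ge_0 _)). lra. }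
  assert (inside : forall x, unit_disc x -> Cmod (taylor p n x) <= 1).
  { intros x Hx. apply le_epsilon. intros eps Heps.
    destruct (pow_lt_1_zero (Cmod x)) with (y := eps / B) as [M HM].
    - rewrite Rabs_pos_eq; [exact Hx|apply Cmod_ge_0].
    - now apply Rdiv_lt_0_compat.
    - specialize (HM M (Nat.le_refl _)).
      rewrite Rabs_pos_eq in HM by apply pow_le, Cmod_ge_0.
      apply Rle_trans with (1 + B * Cmod x ^ M).
      { now apply (partial_sum_almost_bounded g d n M z x). }
      apply (Rmult_lt_compat_l B) in HM; [|assumption].
      replace (B * (eps / B)) with eps in HM by (field; lra). lra. }
  replace (taylor d n z) with (taylor p n 1).
  2:{ unfold taylor. apply Csum_ext. intros i _. unfold p. rewrite Cpow_1_l. ring. }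
  apply le_epsilon. intros eps Heps.
  destruct (expandable_continuous _ _ (expandable_taylor p n 1) eps Heps) as (r & Hr & H).
  set (s := Rmin (r / 2) (1 / 2)).
  assert (s0 : 0 < s) by (apply Rmin_pos; lra).
  assert (s1 : s <= r / 2) by apply Rmin_l. assert (s2 : s <= 1 / 2) by apply Rmin_r.
  assert (Hs : Cmod (RtoC (1 - s) - 1) < r).
  { rewrite <- RtoC_minus, Cmod_R, Rabs_left by lra. lra. }
  assert (h := H _ Hs).
  assert (k := inside (RtoC (1 - s)) ltac:(unfold unit_disc; rewrite Cmod_R, Rabs_pos_eq; lra)).
  rewrite <- Cmod_opp in h.
  assert (t := Cmod_triangle (taylor p n (RtoC (1 - s)))
                 (- (taylor p n (RtoC (1 - s)) - taylor p n 1))%C).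
  replace (_ + - _)%C with (taylor p n 1) in t by ring. lra.
Qed.

(** * Subordination *)

(** Coefficients of [z^m] times the function with coefficients [c]. *)
Fixpoint delay (m : nat) (c : nat -> C) : nat -> C :=
  match m with
  | O => c
  | S m => fun i => match i with O => RtoC 0 | S j => delay m c j end
  end.

Lemma asymp_delay F c m : asymp F 0 c -> asymp (fun z => z ^ m * F z)%C 0 (delay m c).
Proof.
  intros H. induction m as [|m IH].
  - apply asymp_ext_near with (3 := H) (r := 1); [lra|]. intros z _. simpl. ring.
  - apply asymp_ext_near with (3 := asymp_mult_id _ _ IH) (r := 1); [lra|].
    intros z _. simpl. ring.
Qed.

(** The partial sum of order [k] of [z^m F] is [z^m] times the one of order
    [k - m] of [F], or 0 if [k < m]. *)
Lemma taylor_delay_bound c z m :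
  (forall n, Cmod (taylor c n z) <= 1) ->
  forall k, Cmod (taylor (delay m c) k z) <= Cmod z ^ m.
Proof.
  intros H. induction m as [|m IH]; intros k; [apply H|].
  assert (p0 : 0 <= Cmod z ^ S m) by apply pow_le, Cmod_ge_0.
  destruct k as [|k].
  - rewrite taylor_O. simpl delay. now rewrite Cmod_0.
  - rewrite taylor_head. simpl delay. rewrite Cplus_0_l, Cmod_mult. simpl.
    apply Rmult_le_compat_l; [apply Cmod_ge_0|]. apply IH.
Qed.

Lemma bigO_leading x m : bigO (S m) (fun w => w ^ m * x)%C -> x = 0%C.
Proof.
  intros (K & r & Hr & H). apply NNPP. intros nx.
  assert (x0 : 0 < Cmod x) by now apply Cmod_gt_0.
  assert (K0 := Rabs_pos K). assert (K1 := Rle_abs K).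
  set (t := Rmin (r / 2) (Cmod x / (2 * (Rabs K + 1)))).
  assert (t0 : 0 < t) by (apply Rmin_pos; [lra|apply Rdiv_lt_0_compat; lra]).
  assert (t1 : t < r) by (unfold t; generalize (Rmin_l (r / 2) (Cmod x / (2 * (Rabs K + 1)))); lra).
  assert (t2 : t * (2 * (Rabs K + 1)) <= Cmod x).
  { apply Rle_trans with (Cmod x / (2 * (Rabs K + 1)) * (2 * (Rabs K + 1))).
    - apply Rmult_le_compat_r; [lra|apply Rmin_r].
    - right. field. lra. }
  assert (m1 : Cmod (RtoC t) = t) by (rewrite Cmod_R; apply Rabs_pos_eq; lra).
  assert (h := H (RtoC t) ltac:(lra)).
  rewrite Cmod_mult, Cmod_pow, m1 in h.
  assert (tm : 0 < t ^ m) by now apply pow_lt.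
  assert (Cmod x <= K * t).
  { apply Rmult_le_reg_l with (t ^ m); [assumption|]. simpl in h. lra. }
  nra.
Qed.

(** Uniqueness of the coefficients.  The factor [w^m] lets the induction peel off
    constant terms without dividing by [w]. *)
Lemma taylor_small_zero k : forall m e,
  bigO (S (k + m)) (fun w => w ^ m * taylor e k w)%C ->
  forall i, (i <= k)%nat -> e i = 0%C.
Proof.
  induction k as [|k IH]; intros m e H.
  - intros i Hi. replace i with O by lia. apply bigO_leading with m.
    apply bigO_ext with (2 := H). intros w. now rewrite taylor_O.
  - assert (e0 : e O = 0%C).
    { apply bigO_leading with m.
      apply bigO_ext with (fun w => w ^ m * taylor e (S k) w
                                    - w ^ S m * taylor (shift e) k w)%C.
      { intros w. rewrite taylor_head. simpl. ring. }
      apply bigO_minus.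
      - apply bigO_le with (2 := H). lia.
      - rewrite <- (Nat.add_0_r (S m)) at 1. apply bigO_pow_mult, bigO_taylor. }
    assert (h : forall i, (i <= k)%nat -> shift e i = 0%C).
    { apply (IH (S m)). rewrite Nat.add_succ_r.
      apply bigO_ext with (2 := H). intros w. rewrite taylor_head, e0. simpl. ring. }
    intros [|i] Hi; [assumption|]. apply h. lia.
Qed.

Theorem theorem7 (f h : C -> C) (a b : nat -> C)
  (f_analytic : analytic_on unit_disc f)
  (h_analytic : analytic_on unit_disc h)
  (f_series : forall z : C, unit_disc z ->
     @is_pseries C_AbsRing C_NormedModule a z (f z))
  (h_series : forall z : C, unit_disc z ->
     @is_pseries C_AbsRing C_NormedModule b z (h z))
  (f_sub_h : subordinate f h)
  (k : nat) (z : C) (hz : (Cmod z <= 1 / 2)%R) :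
  (Cmod (@sum_n C_AbelianMonoid (fun n : nat => (a n * Cpow z n)%C) k)
     <= @sum_n R_AbelianMonoid (fun n : nat => (Cmod (b n) * Cmod z ^ n)%R) k)%R.
Proof.
  destruct f_sub_h as (phi & (phi_analytic & phi_0 & phi_bounded) & f_eq).
  assert (disc_0 : unit_disc 0) by (unfold unit_disc; rewrite Cmod_0; lra).
  assert (phi_expandable : forall x, unit_disc x -> expandable phi x).
  { intros x Hx. now apply analytic_expandable with unit_disc. }
  destruct (phi_expandable 0 disc_0) as [c phi_asymp].
  assert (c0 : c O = 0%C) by (rewrite <- (asymp_value _ _ _ phi_asymp); exact phi_0).
  destruct (schwarz_division phi 1 c) as (psi & psi_exp & phi_eq & psi_bounded & psi_asymp); auto.
  set (q := fun m => conv_pow (shift c) m).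
  assert (pow_asymp : forall m, asymp (fun x => phi x ^ m)%C 0 (delay m (q m))).
  { intros m.
    apply asymp_ext_near with (3 := asymp_delay _ _ m (asymp_pow _ _ _ m psi_asymp)) (r := 1); [lra|].
    intros x _. now rewrite phi_eq, Cpow_mult_l. }
  assert (q_bound : forall m n, Cmod (taylor (q m) n z) <= 1).
  { intros m n. apply partial_sum_bounded with (g := fun x => (psi x ^ m)%C); auto.
    - intros x Hx. apply expandable_pow. auto.
    - intros x Hx. rewrite Cmod_pow, <- (pow1 m). apply pow_incr.
      split; [apply Cmod_ge_0|auto].
    - now apply asymp_pow. }
  set (s := fun i => Csum (fun m => b m * delay m (q m) i)%C k).
  assert (sum_asymp : asymp (fun x => Csum (fun m => b m * phi x ^ m)%C k) 0 s).
  { apply asymp_sum with (F := fun m x => (b m * phi x ^ m)%C)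
      (c := fun m i => (b m * delay m (q m) i)%C).
    intros m _. now apply asymp_scal. }
  assert (f_asymp : asymp f 0 a).
  { apply asymp_pseries with 1; [lra|]. intros w Hw. rewrite Cplus_0_l. now apply f_series. }
  assert (h_asymp : asymp h 0 b).
  { apply asymp_pseries with 1; [lra|]. intros w Hw. rewrite Cplus_0_l. now apply h_series. }
  assert (phi_small : bigO 1 (fun w => phi (0 + w)%C)).
  { apply bigO_ext with (2 := phi_asymp O). intros w. rewrite taylor_O, c0. ring. }
  (* [h o phi] and [sum_(m <= k) b_m phi^m] differ by [O(phi^(k+1))], that is [O(w^(k+1))]. *)
  assert (coef : forall i, (i <= k)%nat -> (a i + (-(1)) * s i)%C = 0%C).
  { apply (taylor_small_zero k 0). rewrite Nat.add_0_r.
    apply bigO_ext_near with (fun w =>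
      ((h (0 + phi (0 + w)%C) - taylor b k (phi (0 + w)%C))
       + (Csum (fun m => b m * phi (0 + w)%C ^ m) k - taylor s k w))
      - (f (0 + w) - taylor a k w))%C 1.
    - lra.
    - intros w Hw. rewrite taylor_plus, taylor_scal, f_eq by now rewrite Cplus_0_l.
      rewrite (Cplus_0_l (phi _)). unfold taylor at 1. simpl. ring.
    - apply bigO_minus; [|apply f_asymp]. apply bigO_plus; [|apply sum_asymp].
      exact (bigO_compose _ _ _ (h_asymp k) phi_small). }
  change (Cmod (taylor a k z) <= Rsum (fun n => Cmod (b n) * Cmod z ^ n) k).
  replace (taylor a k z) with (Csum (fun m => b m * taylor (delay m (q m)) k z)%C k).
  - apply Rle_trans with (1 := Cmod_Csum _ _). apply Rsum_le. intros m _.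
    rewrite Cmod_mult. apply Rmult_le_compat_l; [apply Cmod_ge_0|].
    now apply taylor_delay_bound.
  - rewrite (taylor_ext a s).
    2:{ intros i Hi. replace (a i) with ((a i + (-(1)) * s i) + s i)%C by ring.
        rewrite coef by assumption. ring. }
    unfold taylor, s. symmetry.
    transitivity (Csum (fun i => Csum (fun m => b m * (delay m (q m) i * z ^ i))%C k) k).
    + apply Csum_ext. intros i _. rewrite Cmult_comm, <- Csum_scal.
      apply Csum_ext. intros m _. ring.
    + rewrite Csum_switch. apply Csum_ext. intros m _. apply Csum_scal.
Qed.
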